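(* Let $(X,d)$ be a finite metric space with at least two points such that $\wp(X)<\infty$. Then $$\{p\ge 0 : (X,d)\text{ admits a nontrivial }p\text{-polygonal equality}\}=[\wp(X),\infty).$$
   Context: Convention: $d(x,x)^p = 0$ for all $p \ge 0$, including $p=0$ (i.e. $0^0=0$). A finite metric space $(\{x_1,\dots,x_m\},d)$ with $m$ distinct points is of $p$-negative type ($p\ge 0$) if $\sum_{i,j=1}^m d(x_i,x_j)^p \xi_i\xi_j \le 0$ for all $(\xi_1,\dots,\xi_m)\in\mathbb{R}^m$ with $\sum_i \xi_i = 0$. The supremal $p$-negative type of $(X,d)$ is $\wp(X)=\sup\{p\ge 0 : (X,d)\text{ is of }p\text{-negative type}\}\in[0,\infty]$. A signed simplex $Q=[x_i(m_i);y_j(n_j)]_{s,t}$ in $X$ consists of (not necessarily distinct) points $x_1,\dots,x_s,y_1,\dots,y_t\in X$ together with real weights $m_1,\dots,m_s,n_1,\dots,n_t$ satisfying $m_1+\cdots+m_s=n_1+\cdots+n_t$. Its $p$-simplex gap is $$\gamma_p(Q)=\sum_{i=1}^s\sum_{j=1}^t m_in_j\,d(x_i,y_j)^p-\sum_{1\le i_1<i_2\le s}m_{i_1}m_{i_2}\,d(x_{i_1},x_{i_2})^p-\sum_{1\le j_1<j_2\le t}n_{j_1}n_{j_2}\,d(y_{j_1},y_{j_2})^p.$$ A $p$-polygonal equality in $(X,d)$ is an equality $\gamma_p(Q)=0$ for some signed simplex $Q$ in $X$. A signed simplex $Q$ is nondegenerate if the net weights $\sum_{i: x_i=z}m_i-\sum_{j:y_j=z}n_j$,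 $z\in X$, are not all zero (equivalently, by merging repeated points, cancelling, and moving negative weights to the other side, $Q$ can be reduced to a signed simplex with all points distinct and all weights strictly positive). A $p$-polygonal equality $\gamma_p(Q)=0$ is nontrivial if $Q$ is nondegenerate. *)

(* Defs.v *)
From HB Require Import structures.
From mathcomp Require Import all_boot all_order all_algebra.
From mathcomp Require Import all_classical all_reals all_analysis.

Set Implicit Arguments.
Unset Strict Implicit.
Unset Printing Implicit Defensive.

Import Order.TTheory GRing.Theory Num.Theory.

Local Open Scope classical_set_scope.
Local Open Scope ring_scope.

#[short(type="finMetricType")]
HB.structure Definition FinMetric (K : numDomainType) :=
  { M of Finite M & Metric K M }.

(* The case split enforces d(x, x)^0 = 0, whereas 0 `^ 0 = 1 in the library. *)
Definition mdist_pow (R : realType) (X : finMetricType R) (p : R) (x y : X) : R :=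
  if x == y then 0 else mdist x y `^ p.

Definition negative_type (R : realType) (X : finMetricType R) (p : R) : Prop :=
  forall xi : X -> R, \sum_x xi x = 0 ->
    \sum_x \sum_y mdist_pow p x y * xi x * xi y <= 0.

Definition supremal_negative_type (R : realType) (X : finMetricType R) : \bar R :=
  ereal_sup [set p%:E | p in [set p : R | 0 <= p /\ negative_type X p]].

(* [x_i(m_i); y_j(n_j)]_{s,t}: points may be repeated and weights are
   arbitrary reals. *)
Record signed_simplex (R : realType) (X : finMetricType R) := SignedSimplex {
  ss_s : nat;
  ss_t : nat;
  ss_s_gt0 : (0 < ss_s)%N;
  ss_t_gt0 : (0 < ss_t)%N;
  ss_x : 'I_ss_s -> X;
  ss_y : 'I_ss_t -> X;
  ss_m : 'I_ss_s -> R;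
  ss_n : 'I_ss_t -> R;
  ss_balanced : \sum_i ss_m i = \sum_j ss_n j
}.

Definition simplex_gap (R : realType) (X : finMetricType R) (p : R)
    (Q : signed_simplex X) : R :=
  (\sum_(i < ss_s Q) \sum_(j < ss_t Q)
      ss_m i * ss_n j * mdist_pow p (ss_x i) (ss_y j))
  - (\sum_(i1 < ss_s Q) \sum_(i2 < ss_s Q | (i1 < i2)%N)
      ss_m i1 * ss_m i2 * mdist_pow p (ss_x i1) (ss_x i2))
  - (\sum_(j1 < ss_t Q) \sum_(j2 < ss_t Q | (j1 < j2)%N)
      ss_n j1 * ss_n j2 * mdist_pow p (ss_y j1) (ss_y j2)).

Definition net_weight (R : realType) (X : finMetricType R)
    (Q : signed_simplex X) (z : X) : R :=
  \sum_(i < ss_s Q | ss_x i == z) ss_m i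
  - \sum_(j < ss_t Q | ss_y j == z) ss_n j.

Definition nondegenerate (R : realType) (X : finMetricType R)
    (Q : signed_simplex X) : Prop :=
  exists z : X, net_weight Q z != 0.

Definition admits_nontrivial_polygonal_equality (R : realType)
    (X : finMetricType R) (p : R) : Prop :=
  exists Q : signed_simplex X, nondegenerate Q /\ simplex_gap p Q = 0.

(* Main.v *)
Require Import Defs.
From mathcomp Require Import all_boot all_order all_algebra.
From mathcomp Require Import all_classical all_reals all_analysis.
From mathcomp Require Import ring lra.

(** Up to the factor -1/2, the gap of a signed simplex is the quadratic form of
    the kernel [d(x, y) ^ p] at its net weights, and the net weights range over
    all vectors of sum zero ([admits_nontrivialE]). So a nontrivial
    [p]-polygonal equality is a nonzero zero of this form on the hyperplane of
    vectors of sum zero, and two facts have to be shown.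

    No zero below the supremum. If [X] has [q]-negative type then the form is
    strictly negative for [0 <= p < q] ([strict_negative_type_lt]). Put
    [D = d ^ q] and [a = p / q]. By the Schur product theorem ([psdM]) and
    Schoenberg's argument ([psd_expRN]) every kernel [expR (- c D)] with
    [c >= 0] is positive semidefinite, and it tends to the identity matrix as
    [c] grows. The power [D ^ a] is the limit of [(n (1 - u)) ^ a] with
    [u = expR (- D / n)], and the binomial series of [(1 - u) ^ a] has
    nonpositive coefficients after the constant term; the constant term
    vanishes on the hyperplane, and the powers [u ^ k = expR (- k D / n)] give
    nonpositive contributions, so the limit form is nonpositive. To see that it
    is negative, keep only the terms with [k >= S n], where [S] is such that
    [expR (- c D)] is at least half the identity for [c >= S]: their
    coefficients have total weight at least a constant times [(S n) ^ (- a)]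
    ([binom_tail_ge]), which cancels the factor [n ^ a]. This discretizes
    the usual representation of [t ^ a] as the integral of
    [(1 - expR (- c t)) c ^ (- 1 - a)] over [c > 0].

    A zero from the supremum on. If the form at [p] has no nonzero zero on the
    hyperplane then it is strictly negative there, because it is negative at
    the difference of two unit vectors and, if nonnegative elsewhere, would have
    a zero on some line ([strict_of_no_zero]). By compactness of the unit sphere
    strict negativity persists for exponents near [p]
    ([strict_negative_type_open]), so the supremum exceeds [p]. *)

Set Implicit Arguments.
Unset Strict Implicit.
Unset Printing Implicit Defensive.

Import Order.TTheory GRing.Theory Num.Theory.
Import numFieldNormedType.Exports.

Local Open Scope classical_set_scope.
Local Open Scope ring_scope.

(** * Positive and conditionally negative kernels on a finite set *)

Definition qform (R : realType) (X : finType) (D : X -> X -> R) (xi : X -> R) : R :=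
  \sum_x \sum_y D x y * xi x * xi y.

Definition psd (R : realType) (X : finType) (K : X -> X -> R) : Prop :=
  (forall x y, K x y = K y x) /\ (forall xi, 0 <= qform K xi).

Definition cnd (R : realType) (X : finType) (D : X -> X -> R) : Prop :=
  forall xi : X -> R, \sum_x xi x = 0 -> qform D xi <= 0.

Section Forms.
Variables (R : realType) (X : finType).
Implicit Types (K L D : X -> X -> R) (xi f g : X -> R).

Lemma sum_delta (F : X -> R) a : \sum_z F z * (z == a)%:R = F a.
Proof.
rewrite (bigD1 a) //= eqxx mulr1 big1 ?addr0 // => z /negbTE->.
by rewrite mulr0.
Qed.

Lemma eq_qform K L xi : (forall x y, K x y = L x y) -> qform K xi = qform L xi.
Proof.
by move=> KL; apply: eq_bigr => x _; apply: eq_bigr => y _; rewrite KL.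
Qed.

Lemma eq_qformr K f g : f =1 g -> qform K f = qform K g.
Proof.
by move=> fg; apply: eq_bigr => x _; apply: eq_bigr => y _; rewrite !fg.
Qed.

Lemma qformD K L xi :
  qform (fun x y => K x y + L x y) xi = qform K xi + qform L xi.
Proof.
rewrite -big_split; apply: eq_bigr => x _; rewrite -big_split.
by apply: eq_bigr => y _; rewrite /= !mulrDl.
Qed.

Lemma qformZ c K xi : qform (fun x y => c * K x y) xi = c * qform K xi.
Proof.
rewrite mulr_sumr; apply: eq_bigr => x _; rewrite mulr_sumr.
by apply: eq_bigr => y _; rewrite !mulrA.
Qed.

Lemma qform_sum (I : Type) (r : seq I) (P : pred I) (K : I -> X -> X -> R) xi :
  qform (fun x y => \sum_(i <- r | P i) K i x y) xi
  = \sum_(i <- r | P i) qform (K i) xi.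
Proof.
rewrite exchange_big; apply: eq_bigr => x _; rewrite exchange_big.
by apply: eq_bigr => y _; rewrite !mulr_suml.
Qed.

Lemma qform_weight K f xi :
  qform (fun x y => f x * f y * K x y) xi = qform K (fun x => f x * xi x).
Proof. by apply: eq_bigr => x _; apply: eq_bigr => y _; ring. Qed.

Lemma qform_rank1 f xi : qform (fun x y => f x * f y) xi = (\sum_x f x * xi x) ^+ 2.
Proof.
rewrite expr2 mulr_suml; apply: eq_bigr => x _; rewrite mulr_sumr.
by apply: eq_bigr => y _; ring.
Qed.

Lemma qform_const1 xi : qform (fun _ _ => 1) xi = (\sum_x xi x) ^+ 2.
Proof.
rewrite -[in RHS](eq_bigr _ (fun x _ => mul1r (xi x))) -(qform_rank1 (fun=> 1)).
by apply: eq_qform => x y; rewrite mulr1.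
Qed.

Lemma qform_diag xi : qform (fun x y => (x == y)%:R) xi = \sum_x xi x ^+ 2.
Proof.
apply: eq_bigr => x _; rewrite (bigD1 x) //= big1 ?addr0 ?eqxx ?mul1r ?expr2 //.
by move=> y; rewrite eq_sym => /negbTE->; rewrite !mul0r.
Qed.

Lemma qform_line K f g t : (forall x y, K x y = K y x) ->
  qform K (fun x => f x + t * g x)
  = qform K f + t * (2 * \sum_x \sum_y K x y * f x * g y) + t ^+ 2 * qform K g.
Proof.
move=> Ksym; set B := \sum_x _.
have BE : B = \sum_x \sum_y K x y * g x * f y.
  rewrite /B exchange_big; apply: eq_bigr => x _; apply: eq_bigr => y _.
  by rewrite [K y x]Ksym mulrAC.
have -> : t * (2 * B) = t * B + t * B by ring.
rewrite {2}BE /B /qform !mulr_sumr -!big_split; apply: eq_bigr => x _ /=.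
rewrite !mulr_sumr -!big_split; apply: eq_bigr => y _ /=; ring.
Qed.

Lemma cvg_qform (T : Type) (F : set_system T) (FF : Filter F)
    (K : T -> X -> X -> R) L xi :
  (forall x y, K t x y @[t --> F] --> L x y) ->
  qform (K t) xi @[t --> F] --> qform L xi.
Proof.
move=> KL; apply: cvg_big => [|x _]; first exact: add_continuous.
apply: cvg_big => [|y _]; first exact: add_continuous.
by apply: cvgMr_tmp; apply: cvgMr_tmp; exact: KL.
Qed.

Lemma psdZ c K : 0 <= c -> psd K -> psd (fun x y => c * K x y).
Proof.
move=> c0 [Ks Kp]; split=> [x y|xi]; first by rewrite Ks.
by rewrite qformZ mulr_ge0.
Qed.

Lemma psd_sum (I : Type) (r : seq I) (K : I -> X -> X -> R) :
  (forall i, psd (K i)) -> psd (fun x y => \sum_(i <- r) K i x y).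
Proof.
move=> Kp; split=> [x y|xi]; first by apply: eq_bigr => i _; case: (Kp i).
by rewrite qform_sum sumr_ge0 // => i _; case: (Kp i).
Qed.

Lemma psd_weight f K : psd K -> psd (fun x y => f x * f y * K x y).
Proof.
by move=> [Ks Kp]; split=> [x y|xi]; rewrite ?qform_weight // Ks mulrC [f x * _]mulrC mulrC.
Qed.

Lemma qform_two K x y s t : (forall x y, K x y = K y x) ->
  qform K (fun z => s * (z == x)%:R + t * (z == y)%:R)
  = s ^+ 2 * K x x + 2 * s * t * K x y + t ^+ 2 * K y y.
Proof.
move=> Ks.
rewrite qform_line // /qform.
have E a b c : \sum_z \sum_w K z w * (c * (z == a)%:R) * (w == b)%:R = c * K a b.
  under eq_bigr do rewrite sum_delta mulrCA.
  by rewrite -mulr_sumr sum_delta.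
have -> : \sum_z \sum_w K z w * (s * (z == x)%:R) * (s * (w == x)%:R) = s ^+ 2 * K x x.
  transitivity (s * \sum_z \sum_w K z w * (s * (z == x)%:R) * (w == x)%:R).
    rewrite mulr_sumr; apply: eq_bigr => z _; rewrite mulr_sumr.
    by apply: eq_bigr => w _; ring.
  by rewrite E; ring.
rewrite E; under [X in _ + t ^+ 2 * X = _]eq_bigr do rewrite sum_delta.
by rewrite sum_delta; ring.
Qed.

Lemma psd_diag_ge0 K x : psd K -> 0 <= K x x.
Proof.
move=> [Ks Kp]; have := Kp (fun z => 1 * (z == x)%:R + 0 * (z == x)%:R).
by rewrite qform_two // !(mulr0, mul0r, expr0n, expr1n, addr0, mul1r).
Qed.

(** If [K x x = 0] then the form is affine along the line through the unit
    vector at [y] in the direction of the unit vector at [x]; being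
    nonnegative, it has slope zero. *)
Lemma psd_diag0 K x y : psd K -> K x x = 0 -> K x y = 0.
Proof.
move=> [Ks Kp] Kxx; apply/eqP/negP => /negP K0.
set a := K x y in K0.
(* This point of the line is where the affine function takes the value -1. *)
have := Kp (fun z => (- (K y y + 1) / (2 * a)) * (z == x)%:R + 1 * (z == y)%:R).
rewrite qform_two // Kxx -/a expr1n mulr0 add0r mulr1 mul1r.
have -> : 2 * (- (K y y + 1) / (2 * a)) * a = - (K y y + 1) by field.
lra.
Qed.

(** One step of Gaussian elimination keeps the form positive: on each line
    parallel to the pivot axis the old form is a parabola whose minimum is the
    new form. *)
Lemma psd_pivot K x : psd K -> 0 < K x x ->
  psd (fun y z => K y z - K y x * K x z / K x x).
Proof.
move=> [Ks Kp] Kx; split=> [y z|xi].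
  by rewrite [K y z]Ks [K z x]Ks [K y x]Ks [K x y * _]mulrC.
set b := \sum_y K y x * xi y.
have := Kp (fun y => xi y + (- b / K x x) * (y == x)%:R).
rewrite qform_line //.
have -> : \sum_z \sum_w K z w * xi z * (w == x)%:R = b.
  by apply: eq_bigr => z _; rewrite sum_delta.
have -> : qform K (fun y => (y == x)%:R) = K x x.
  by rewrite /qform; under eq_bigr do rewrite sum_delta; rewrite sum_delta.
move=> H; apply: le_trans H _; rewrite le_eqVlt; apply/orP; left; apply/eqP.
have -> : qform (fun y z => K y z - K y x * K x z / K x x) xi
   = qform K xi + - (K x x)^-1 * b ^+ 2.
  rewrite -[b ^+ 2](qform_rank1 (fun y => K y x)) -qformZ -qformD.
  by apply: eq_qform => y z; rewrite [K x z]Ks; ring.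
by field; rewrite gt_eqF.
Qed.

(** Schur product theorem, by induction on the number of nonzero diagonal
    entries: one elimination step writes [K] as a rank-one form, for which
    the product with [L] is a reweighting of [L], plus a form with fewer
    nonzero rows. *)
Lemma psdM K L : psd K -> psd L -> psd (fun x y => K x y * L x y).
Proof.
move=> + [Ls Lp]; have [n] := ubnP #|[set x | K x x != 0%R]%SET|.
elim: n K => // n IHn K leKn Kpsd; have [Ks Kp] := Kpsd.
split=> [x y|xi]; first by rewrite Ks Ls.
have [/existsP[x Kxx]|] := boolP [exists x, K x x != 0]; last first.
  rewrite negb_exists => /forallP K0.
  rewrite (eq_qform (L := fun x y => 0 * L x y)) ?qformZ ?mul0r // => x y.
  by rewrite psd_diag0 //; apply/eqP; have := K0 x; rewrite negbK.
have Kx : 0 < K x x by rewrite lt_def Kxx psd_diag_ge0.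
have Ppsd := psd_pivot Kpsd Kx; set P := fun y z => _ in Ppsd.
have leP : (#|[set x | P x x != 0%R]%SET| < n)%N.
  rewrite -ltnS (leq_trans _ leKn) // ltnS; apply: proper_card.
  apply/properP; split; last first.
    by exists x; rewrite inE // /P mulfK // subrr eqxx.
  apply/fintype.subsetP => y; rewrite !inE; apply: contra => /eqP Ky.
  by rewrite /P Ky psd_diag0 // !mul0r subrr.
have [_ /(_ xi) PL] := IHn _ leP Ppsd.
pose f y := K y x.
rewrite (eq_qform (L := fun y z =>
    P y z * L y z + (K x x)^-1 * (f y * f z * L y z))); last first.
  by move=> y z; rewrite /P /f [K z x]Ks; ring.
rewrite qformD qformZ qform_weight addr_ge0 // mulr_ge0 ?Lp //.
by rewrite invr_ge0 ltW.
Qed.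

Lemma psd_const1 : psd (fun _ _ : X => 1 : R).
Proof.
by split=> // xi; rewrite qform_const1 sqr_ge0.
Qed.

Lemma psdX K n : psd K -> psd (fun x y => K x y ^+ n).
Proof.
move=> Kp; elim: n => [|n IHn]; first exact: psd_const1.
under eq_fun do under eq_fun do rewrite exprS.
exact: psdM.
Qed.

(** The exponential is a limit of polynomials with nonnegative coefficients,
    so the Schur product theorem carries over to it. *)
Lemma psd_expR K : psd K -> psd (fun x y => expR (K x y)).
Proof.
move=> Kp; split=> [x y|xi]; first by case: Kp => ->.
have c : qform (fun x y => series (exp_coeff (K x y)) n) xi @[n --> \oo]
    --> qform (fun x y => expR (K x y)) xi.
  by apply: cvg_qform => x y; exact: is_cvg_series_exp_coeff.
rewrite -(cvg_lim _ c) //; apply: limr_ge; first by apply: cvgP c.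
near=> n; suff [_ /(_ xi)] : psd (fun x y => series (exp_coeff (K x y)) n) by [].
apply: psd_sum => k; under eq_fun do under eq_fun do rewrite exp_coeffE.
by apply: psdZ; [rewrite invr_ge0 | exact: psdX].
Unshelve. all: by end_near. Qed.

(** Schoenberg's theorem. Up to the separated terms [D x b + D y b], for a
    base point [b], a conditionally negative [D] is the opposite of a positive
    kernel [K]; hence [expR (- D)] is a reweighting of [expR K]. *)
Lemma psd_expRN D c : (forall x y, D x y = D y x) -> (forall x, D x x = 0) ->
  cnd D -> 0 <= c -> psd (fun x y => expR (- (c * D x y))).
Proof.
move=> Ds D0 Dn c0.
have [b _|X0] := pickP X; last first.
  by split=> [x|xi]; [have := X0 x | rewrite /qform big1 // => x; have := X0 x].
pose K x y := D x b + D b y - D x y.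
have Kp : psd K.
  split=> [x y|xi]; first by rewrite /K [D x b]Ds [D b y]Ds [D x y]Ds; ring.
  (* Moving the total mass of [xi] to the base point [b] gives a vector of
     mass zero. *)
  pose s := \sum_x xi x.
  have := Dn (fun x => xi x + - s * (x == b)%:R).
  rewrite big_split /= (sum_delta (fun=> - s)) subrr => /(_ erefl).
  rewrite qform_line //.
  under [X in 2 * X]eq_bigr do rewrite sum_delta.
  have -> : qform D (fun y => (y == b)%:R) = 0.
    by rewrite /qform; under eq_bigr do rewrite sum_delta; rewrite sum_delta.
  rewrite mulr0 addr0 => H.
  have -> : qform K xi = s * (2 * \sum_x D x b * xi x) - qform D xi.
    have E1 : qform (fun x y => D x b) xi = s * \sum_x D x b * xi x.
      rewrite mulrC mulr_suml; apply: eq_bigr => x _.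
      by rewrite mulr_sumr.
    have E2 : qform (fun x y => D b y) xi = s * \sum_x D x b * xi x.
      rewrite -E1 /qform exchange_big; apply: eq_bigr => x _.
      by apply: eq_bigr => y _; rewrite Ds mulrAC.
    rewrite /K !qformD E1 E2.
    rewrite (eq_qform (K := fun x y => - D x y) (L := fun x y => -1 * D x y)).
      by rewrite qformZ; ring.
    by move=> x y; rewrite mulN1r.
  lra.
have := psd_weight (fun x => expR (- (c * D x b))) (psd_expR (psdZ c0 Kp)).
congr psd; apply/funext => x; apply/funext => y.
rewrite -!expRD; congr expR; rewrite /K [D b y]Ds; ring.
Qed.

End Forms.

(** * The binomial series of a power between 0 and 1 *)

(** The total weight, up to sign, of the coefficients of degree above [n] in
    the binomial series of [(1 - u) `^ a], in closed form. *)
Definition binom_tail (R : realType) (a : R) (n : nat) : R :=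
  \prod_(k < n) (1 - a / k.+1%:R).

(** The degree [n] Taylor polynomial of [(1 - u) `^ a] at [0]; writing its
    coefficients as differences makes their sign and their sums evident. *)
Definition binom_poly (R : realType) (a : R) (n : nat) : {poly R} :=
  1 - \sum_(k < n) (binom_tail a k - binom_tail a k.+1) *: 'X^(k.+1).

Section Binomial.
Variables (R : realType) (a : R).
Hypotheses (a0 : 0 < a) (a1 : a < 1).
Local Notation T := (binom_tail a).
Local Notation S := (binom_poly a).

Lemma binom_tailS n : T n.+1 = T n * (1 - a / n.+1%:R).
Proof. by rewrite /binom_tail big_ord_recr. Qed.

Lemma binom_factor_itv n : 0 < 1 - a / n.+1%:R <= 1.
Proof.
rewrite subr_gt0 ltr_pdivrMr ?ltr0n // mul1r (lt_le_trans a1) ?ler1n //=.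
by rewrite gerBl divr_ge0 // ltW.
Qed.

Lemma binom_tail_itv n : 0 < T n <= 1.
Proof.
elim: n => [|n /andP[T0 T1]]; first by rewrite /binom_tail big_ord0 ltr01 lexx.
have /andP[f0 f1] := binom_factor_itv n.
by rewrite binom_tailS mulr_gt0 // mulr_ile1 // ltW.
Qed.

Lemma binom_tail_le n : T n.+1 <= T n.
Proof.
have /andP[T0 _] := binom_tail_itv n; have /andP[_ f1] := binom_factor_itv n.
by rewrite binom_tailS ler_piMr // ltW.
Qed.

(** Bernoulli's inequality [(1 - 1/k) `^ a <= 1 - a/k] bounds the factors from
    below by those of a telescoping product. *)
Lemma binom_tail_ge n : (1 - a) * n.+1%:R `^ (- a) <= T n.+1.
Proof.
elim: n => [|n IHn].
  by rewrite binom_tailS /binom_tail big_ord0 powR1 mulr1 mul1r divr1.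
rewrite binom_tailS.
have B : (n.+1%:R / n.+2%:R) `^ a <= 1 - a / n.+2%:R :> R.
  have a1' : 0 < 1 - a by rewrite subr_gt0.
  (* Young's inequality for the exponents [1/a] and [1/(1-a)]. *)
  have := @conjugate_powR R ((n.+1%:R / n.+2%:R) `^ a) 1 a^-1 (1 - a)^-1.
  rewrite powR_ge0 ler01 !invr_gt0 a0 a1' !invrK addrC subrK mulr1 powR1 mul1r.
  rewrite -powRrM divff ?gt_eqF // powRr1 ?divr_ge0 // => /(_ isT isT isT isT erefl).
  move=> H; apply: le_trans H _; rewrite le_eqVlt; apply/orP; left; apply/eqP.
  have m0 : n.+2%:R != 0 :> R by rewrite pnatr_eq0.
  by rewrite -[in LHS](@natr1 R n.+1) in m0 *; field.
have H0 : 0 <= (1 - a) * n.+1%:R `^ (- a) by rewrite mulr_ge0 ?powR_ge0 // subr_ge0 ltW.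
apply: le_trans (ler_pM H0 _ IHn B); last exact: powR_ge0.
rewrite powRM ?invr_ge0 // -mulrA [X in _ <= _ * X]mulrA -powRD ?pnatr_eq0 ?implybT //.
by rewrite addNr powRr0 mul1r -powR_inv1 // -powRrM mulN1r.
Qed.

Lemma binom_polyS n :
  S n.+1 = S n - (T n - T n.+1) *: 'X^(n.+1).
Proof. by rewrite /binom_poly big_ord_recr /= opprD addrA. Qed.

Lemma binom_poly1 n : (S n).[1] = T n.
Proof.
elim: n => [|n IHn].
  by rewrite /binom_poly /binom_tail !big_ord0 subr0 hornerC.
by rewrite binom_polyS hornerD hornerN hornerZ hornerXn IHn expr1n; ring.
Qed.

(** The function [(1 - u) `^ a] satisfies [(1 - u) f' + a f = 0]; its Taylor
    polynomial does so up to the top term. *)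
Lemma binom_poly_ode n u :
  (1 - u) * (S n)^`().[u] + a * (S n).[u] = a * T n * u ^+ n.
Proof.
elim: n => [|n IHn].
  by rewrite /binom_poly /binom_tail !big_ord0 subr0 derivC !hornerE.
rewrite binom_polyS derivB derivZ derivXn hornerD !hornerN !hornerZ hornerXn.
rewrite hornerD hornerN hornerZ hornerMn hornerXn.
have E : T n - T n.+1 = T n * a / n.+1%:R by rewrite binom_tailS; ring.
have -> : (T n - T n.+1) * (u ^+ n *+ n.+1) = a * T n * u ^+ n.
  by rewrite -mulr_natr E; field; rewrite nat1r pnatr_eq0.
rewrite mulrBr mulrBr addrACA IHn exprS.
by ring.
Qed.

(** The quotient of [binom_poly a n] by [(1 - u) `^ a] is [1] at [0], and by
    the differential equation its derivative is [O(u ^+ n)] away from [1]; the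
    mean value theorem concludes. *)
Lemma cvg_binom_poly (u : R) : 0 <= u < 1 -> (S n).[u] @[n --> \oo] --> (1 - u) `^ a.
Proof.
move=> /andP[u0 u1].
have S0 n : (S n).[0] = 1.
  elim: n => [|n IHn]; first by rewrite /binom_poly big_ord0 subr0 hornerC.
  by rewrite binom_polyS hornerD hornerN hornerZ hornerXn IHn expr0n mulr0 subr0.
pose M := (1 - u) `^ (- a - 1).
have bnd n : (1 - u) `^ a <= (S n).[u] <= (1 - u) `^ a * (1 + M * u ^+ n).
  pose f v := (S n).[v] * (1 - v) `^ (- a).
  pose df v := a * T n * v ^+ n * (1 - v) `^ (- a - 1).
  have fdf (v : R) : v < 1 -> is_derive v 1 f (df v).
    move=> v1; have v1' : 0 < 1 - v by rewrite subr_gt0.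
    have Dp : is_derive v 1 (fun w : R => (1 - w) `^ (- a)) (- (- a * (1 - v) `^ (- a - 1))).
      have Di : is_derive v 1 (fun w : R => 1 - w) (-1).
        by have := is_deriveB (is_derive_cst (1 : R) v 1) (is_derive_id v 1); rewrite sub0r.
      have := is_derive1_powR (- a) v1' => Dq.
      have := @is_derive1_comp R ((@powR R)^~ (- a)) (fun w : R => 1 - w) v _ _ Dq Di.
      by rewrite mulrN1.
    have H := is_deriveM (is_derive_poly (S n) v) Dp.
    apply: (is_derive_eq H); rewrite /df -binom_poly_ode /GRing.scale /=.
    have -> : (1 - v) `^ (- a) = (1 - v) * (1 - v) `^ (- a - 1).
      rewrite -[X in _ = X * _](powRr1 (ltW v1')) -powRD ?(gt_eqF v1') ?implybT //.
      by congr (_ `^ _); ring.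
    ring.
  have fc : {within `[0, u], continuous f}.
    apply: derivable_within_continuous => v; rewrite in_itv /= => /andP[_ vu].
    by have [] := fdf v (le_lt_trans vu u1).
  have [|c] := MVT_segment u0 _ fc (df := df).
    move=> v; rewrite in_itv /= => /andP[_ vu]; exact: fdf (lt_trans vu u1).
  rewrite in_itv /= => /andP[c0 cu].
  rewrite {2}/f S0 subr0 powR1 mulr1 subr0 => E.
  have u1' : 0 < 1 - u by rewrite subr_gt0.
  have Fu : (S n).[u] = (1 - u) `^ a * (1 + df c * u).
    have <- : f u = 1 + df c * u by rewrite -E; ring.
    rewrite /f mulrCA -powRD ?subrr ?powRr0 ?mulr1 //.
    by rewrite (gt_eqF u1') implybT.
  have /andP[T0 T1] := binom_tail_itv n.
  have df0 : 0 <= df c.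
    by rewrite !mulr_ge0 ?powR_ge0 ?exprn_ge0 // ltW.
  have dfu0 : 0 <= df c * u by exact: mulr_ge0.
  rewrite Fu ler_peMr ?powR_ge0 ?lerDl //=.
  rewrite ler_wpM2l ?powR_ge0 // lerD2l.
  apply: (@le_trans _ _ (df c)); first by rewrite ler_piMr // ltW.
  rewrite /df mulrC; apply: ler_pM; first exact: powR_ge0.
  - by rewrite !mulr_ge0 ?exprn_ge0 // ltW.
  - have c1' : 0 < 1 - c by rewrite subr_gt0 (le_lt_trans cu).
    rewrite /M -opprD !powRN lef_pV2 ?posrE ?powR_gt0 //.
    apply: ge0_ler_powR; rewrite ?nnegrE ?lerD2l ?lerN2 //; apply: ltW => //.
    by rewrite addr_gt0.
  have aT0 : 0 <= a * T n by rewrite mulr_ge0 // ltW.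
  have aT1 : a * T n <= 1 by rewrite mulr_ile1 // ltW.
  rewrite -[leRHS]mul1r; apply: ler_pM; rewrite ?exprn_ge0 //.
  by rewrite lerXn2r // nnegrE.
apply: (squeeze_cvgr (nearW _ bnd)); first exact: cvg_cst.
rewrite -[X in _ --> X]mulr1; apply: cvgMl_tmp.
rewrite -[X in _ --> X]addr0; apply: cvgD; first exact: cvg_cst.
rewrite -[X in _ --> X](mulr0 M); apply: cvgMl_tmp.
by apply: cvg_expr; rewrite ger0_norm.
Qed.

End Binomial.

(** * Powers of conditionally negative kernels are strictly negative *)

Section Strict.
Variables (R : realType) (X : finType) (D : X -> X -> R) (a : R).
Hypotheses (Dsym : forall x y, D x y = D y x) (D0 : forall x, D x x = 0).
Hypotheses (Dgt0 : forall x y, x != y -> 0 < D x y) (Dcnd : cnd D).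
Hypotheses (a0 : 0 < a) (a1 : a < 1).

Local Notation heat c xi := (qform (fun x y => expR (- (c * D x y))) xi).

(** As [c] grows, [expR (- c D)] tends to the identity matrix. *)
Lemma qform_expRN_large (xi : X -> R) : 0 < \sum_x xi x ^+ 2 ->
  exists2 S : nat, (0 < S)%N &
    forall c, S%:R <= c -> (\sum_x xi x ^+ 2) / 2 <= heat c xi.
Proof.
move=> N0; set N := \sum_x _ in N0 *.
have : heat c xi @[c --> +oo] --> N.
  rewrite /N -qform_diag; apply: cvg_qform => x y.
  have [->|xy] := eqVneq x y.
    under eq_fun do rewrite D0 mulr0 oppr0 expR0; exact: cvg_cst.
  apply: (@cvg_comp _ _ _ (fun c => c * D x y) (fun c => expR (- c)) _ +oo).
    by apply: gt0_cvgMly => //; exact: Dgt0.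
  exact: cvgr_expR.
move=> /cvgr_ge /(_ (N / 2)); rewrite ltr_pdivrMr // ltr_pMr // ltr1n => /(_ isT).
move=> [M [Mr MP]]; exists (Num.truncn `|M|).+2 => // c Mc; apply: MP.
rewrite (le_lt_trans (ler_norm M)) // (lt_le_trans _ Mc) //.
by rewrite (lt_trans (truncnS_gt _)) // ltr_nat.
Qed.

(** The diagonal is cut out so that only values [u < 1] enter the binomial
    series: at [u = 1] its partial sums are positive, but their limit is zero. *)
Definition offdiag_form (f : R -> R) (xi : X -> R) :=
  qform (fun x y => if x == y then 0 else f (D x y)) xi.

(** Put [u = expR (- D / n)]. Since [xi] has sum zero, the constant term of
    the polynomial contributes nothing, and its term in [u ^+ k] contributes a
    nonpositive multiple of [heat (k / n) xi], which is at least half the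
    squared norm once [k >= S n]; the absolute values of these coefficients add
    up to [binom_tail a (S n) - binom_tail a N]. Removing the diagonal, where
    the polynomial has the value [binom_tail a N], supplies the missing
    [binom_tail a N]. *)
Lemma offdiag_binom_le (xi : X -> R) (S n N : nat) :
  (0 < n)%N -> (S * n <= N)%N -> 0 < \sum_x xi x ^+ 2 -> \sum_x xi x = 0 ->
  (forall c, S%:R <= c -> (\sum_x xi x ^+ 2) / 2 <= heat c xi) ->
  offdiag_form (fun d => (binom_poly a N).[expR (- (n%:R^-1 * d))]) xi
    <= - ((\sum_x xi x ^+ 2) / 2 * binom_tail a (S * n)).
Proof.
move=> n0 SN Q0 xi0 large; set Q := \sum_x xi x ^+ 2 in Q0 large *.
pose G c := heat c xi.
pose c k := binom_tail a k - binom_tail a k.+1.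
have c0 k : 0 <= c k by rewrite subr_ge0 binom_tail_le.
have -> : offdiag_form (fun d => (binom_poly a N).[expR (- (n%:R^-1 * d))]) xi
   = - \sum_(k < N) c k * G (k.+1%:R / n%:R) - binom_tail a N * Q.
  rewrite /offdiag_form (eq_qform (L := fun x y => 1 +
    ((-1) * (\sum_(k < N) c k * expR (- (k.+1%:R / n%:R * D x y)))
     + (- binom_tail a N) * (x == y)%:R))).
    rewrite !qformD !qformZ qform_diag qform_sum qform_const1.
    rewrite xi0 expr0n add0r mulN1r mulNr; congr (- _ - _).
    by apply: eq_bigr => k _; rewrite qformZ.
  move=> x y.
  have E : 1 - \sum_(k < N) c k * expR (- (k.+1%:R / n%:R * D x y))
      = (binom_poly a N).[expR (- (n%:R^-1 * D x y))].
    rewrite /binom_poly hornerD hornerN hornerC horner_sum; congr (_ - _).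
    apply: eq_bigr => k _; rewrite hornerZ hornerXn -expRM_natl; congr (_ * expR _).
    by rewrite mulrN mulrA.
  rewrite mulN1r addrA E; case: eqVneq => [->|_]; last by rewrite mulr0 addr0.
  by rewrite D0 mulr0 oppr0 expR0 binom_poly1 mulr1 subrr.
have G0 k : 0 <= G (k.+1%:R / n%:R).
  by have [_ ->] := psd_expRN Dsym D0 Dcnd (divr_ge0 (ler0n R k.+1) (ler0n R n)).
have tele m : \sum_(0 <= k < m) c k = 1 - binom_tail a m.
  elim: m => [|m IHm]; first by rewrite big_geq // /binom_tail big_ord0 subrr.
  by rewrite big_nat_recr //= IHm /c; ring.
have low : Q / 2 * (binom_tail a (S * n) - binom_tail a N)
    <= \sum_(k < N) c k * G (k.+1%:R / n%:R).
  rewrite -(big_mkord xpredT (fun k => c k * G (k.+1%:R / n%:R))).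
  rewrite (big_cat_nat (leq0n _) SN) //=.
  have -> : binom_tail a (S * n) - binom_tail a N = \sum_(S * n <= k < N) c k.
    have := tele N; rewrite (big_cat_nat (leq0n _) SN) //= tele; lra.
  apply: ler_wpDl; first by apply: sumr_ge0 => k _; rewrite mulr_ge0.
  rewrite mulr_sumr; apply: ler_sum_nat => k /andP[kS _].
  rewrite mulrC ler_wpM2l // large // ler_pdivlMr ?ltr0n // -natrM ler_nat.
  exact: leqW.
have /andP[TN _] := binom_tail_itv a0 a1 N.
have := mulr_gt0 TN Q0; lra.
Qed.

(** Let [N] tend to infinity in the previous lemma. The scaling [n `^ a] is
    exactly compensated by the decay of [binom_tail a (S n)], so the bound is
    uniform in [n]. *)
Lemma offdiag_powR_le (xi : X -> R) (S n : nat) :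
  (0 < S)%N -> (0 < n)%N -> 0 < \sum_x xi x ^+ 2 -> \sum_x xi x = 0 ->
  (forall c, S%:R <= c -> (\sum_x xi x ^+ 2) / 2 <= heat c xi) ->
  offdiag_form (fun d => (n%:R * (1 - expR (- (n%:R^-1 * d)))) `^ a) xi
    <= - ((\sum_x xi x ^+ 2) / 2 * ((1 - a) * S%:R `^ (- a))).
Proof.
move=> S0 n0 Q0 xi0 large; set Q := \sum_x xi x ^+ 2 in Q0 large *.
have n0' : 0 < n%:R :> R by rewrite ltr0n.
have u_itv x y : x != y -> 0 <= expR (- (n%:R^-1 * D x y)) < 1.
  by move=> xy; rewrite expR_ge0 expR_lt1 oppr_lt0 mulr_gt0 ?invr_gt0 // Dgt0.
have -> : offdiag_form (fun d => (n%:R * (1 - expR (- (n%:R^-1 * d)))) `^ a) xi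
   = n%:R `^ a * offdiag_form (fun d => (1 - expR (- (n%:R^-1 * d))) `^ a) xi.
  rewrite /offdiag_form -qformZ; apply: eq_qform => x y.
  case: eqVneq => [_|xy]; first by rewrite mulr0.
  have /andP[_ u1] := u_itv _ _ xy.
  by rewrite powRM ?ler0n // subr_ge0 ltW.
have lim : offdiag_form (fun d => (1 - expR (- (n%:R^-1 * d))) `^ a) xi
    <= - (Q / 2 * binom_tail a (S * n)).
  have c : offdiag_form (fun d => (binom_poly a N).[expR (- (n%:R^-1 * d))]) xi @[N --> \oo]
     --> offdiag_form (fun d => (1 - expR (- (n%:R^-1 * d))) `^ a) xi.
    apply: cvg_qform => x y; case: eqVneq => [_|xy]; first exact: cvg_cst.
    exact: cvg_binom_poly (u_itv _ _ xy).
  rewrite -(cvg_lim _ c) //; apply: limr_le; first by apply: cvgP c.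
  by near=> N; apply: offdiag_binom_le => //; near: N; exact: nbhs_infty_ge.
apply: le_trans (ler_wpM2l (powR_ge0 _ _) lim) _.
rewrite mulrN lerN2 [leRHS]mulrCA ler_pM2l ?divr_gt0 //.
case Sn: (S * n)%N => [|m]; first by move/eqP: Sn; rewrite muln_eq0 !gtn_eqF.
apply: le_trans (ler_wpM2l (powR_ge0 _ _) (binom_tail_ge a0 a1 m)).
rewrite -Sn natrM powRM ?ler0n //.
have -> : n%:R `^ a * ((1 - a) * (S%:R `^ (- a) * n%:R `^ (- a)))
  = (1 - a) * S%:R `^ (- a) * (n%:R `^ a * n%:R `^ (- a)) by ring.
by rewrite -powRD ?(gt_eqF n0') ?implybT // subrr powRr0 mulr1.
Unshelve. all: by end_near. Qed.

(** With [e = d / n], squeeze between the bounds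
    [1 + e <= expR e] and [1 - e <= expR (- e)]. *)
Lemma cvg_expRN_quotient (d : R) : 0 <= d ->
  n.+1%:R * (1 - expR (- (n.+1%:R^-1 * d))) @[n --> \oo] --> d.
Proof.
move=> d0.
have bnd n : d / (1 + d * n.+1%:R^-1) <= n.+1%:R * (1 - expR (- (n.+1%:R^-1 * d))) <= d.
  have n0 : 0 < n.+1%:R :> R by rewrite ltr0n.
  set e := n.+1%:R^-1 * d.
  have e0 : 0 <= e by rewrite /e mulr_ge0 // invr_ge0 ltW.
  have nd : d = n.+1%:R * e by rewrite /e mulrA divff ?mul1r ?gt_eqF.
  have -> : d / (1 + d / n.+1%:R) = n.+1%:R * (e / (1 + e)).
    by rewrite (mulrC d n.+1%:R^-1) -/e {1}nd mulrA.
  rewrite {1}nd !ler_pM2l //; apply/andP; split; last first.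
    by have := expR_ge1Dx (- e); lra.
  have e1 : 0 < 1 + e by lra.
  have -> : e / (1 + e) = 1 - (1 + e)^-1 by field; rewrite gt_eqF.
  by rewrite lerD2l lerN2 expRN lef_pV2 ?posrE ?expR_gt0 // expR_ge1Dx.
apply: (squeeze_cvgr (nearW _ bnd)); last exact: cvg_cst.
- rewrite -[X in _ --> X]divr1; apply: cvgMl_tmp; apply: cvgV; first exact: oner_neq0.
  rewrite -[X in _ --> X]addr0; apply: cvgD; first exact: cvg_cst.
  rewrite -[X in _ --> X](mulr0 d); apply: cvgMl_tmp; exact: cvg_harmonic.
Qed.

(** Let [n] tend to infinity in [offdiag_powR_le], whose right-hand side does
    not depend on [n]. *)
Lemma offdiag_powR_lt0 (xi : X -> R) :
  (exists x, xi x != 0) -> \sum_x xi x = 0 ->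
  offdiag_form (fun d => d `^ a) xi < 0.
Proof.
move=> [x0 x00] xi0.
have Q0 : 0 < \sum_x xi x ^+ 2.
  rewrite (bigD1 x0) //= ltr_wpDr ?sumr_ge0 // => [x _|]; first exact: sqr_ge0.
  by rewrite exprn_even_gt0.
have [S S0 large] := qform_expRN_large Q0.
have c : offdiag_form (fun d => (n.+1%:R * (1 - expR (- (n.+1%:R^-1 * d)))) `^ a) xi
    @[n --> \oo] --> offdiag_form (fun d => d `^ a) xi.
  apply: cvg_qform => x y; case: eqVneq => [_|xy]; first exact: cvg_cst.
  have d0 := Dgt0 xy.
  apply: (@continuous_cvg _ _ _ _ _ _ (fun z : R => z `^ a)); last exact/cvg_expRN_quotient/ltW.
  by apply: differentiable_continuous; apply/derivable1_diffP; case: (is_derive1_powR a d0).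
apply: (@le_lt_trans _ _ (- ((\sum_x xi x ^+ 2) / 2 * ((1 - a) * S%:R `^ (- a))))).
  rewrite -(cvg_lim _ c) //; apply: limr_le; first by apply: cvgP c.
  by apply: nearW => n; exact: offdiag_powR_le.
by rewrite oppr_lt0 !mulr_gt0 ?subr_gt0 ?powR_gt0 ?ltr0n ?invr_gt0.
Qed.

End Strict.

(** * The simplex gap as a quadratic form *)

Section Simplex.
Variables (R : realType) (X : finMetricType R).
Implicit Types (p q : R) (xi : X -> R) (Q : signed_simplex X).

Lemma mdist_powxx p (x : X) : mdist_pow p x x = 0.
Proof. by rewrite /mdist_pow eqxx. Qed.

Lemma mdist_pow_sym p (x y : X) : mdist_pow p x y = mdist_pow p y x.
Proof. by rewrite /mdist_pow eq_sym metric_sym. Qed.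

Lemma mdist_pow_gt0 p (x y : X) : x != y -> 0 < mdist_pow p x y.
Proof. by move=> xy; rewrite /mdist_pow (negbTE xy) powR_gt0 // mdist_gt0. Qed.

Lemma sum_net_weight Q : \sum_z net_weight Q z = 0.
Proof.
rewrite sumrB.
have E (I : finType) (h : I -> X) (w : I -> R) :
    \sum_z \sum_(i | h i == z) w i = \sum_i w i.
  rewrite (exchange_big_dep xpredT) //=; apply: eq_bigr => i _.
  by under eq_bigl do rewrite eq_sym; rewrite big_pred1_eq.
by rewrite !E ss_balanced subrr.
Qed.

Lemma sum_lt_half n (F : 'I_n -> 'I_n -> R) :
  (forall i j, F i j = F j i) -> (forall i, F i i = 0) ->
  \sum_i \sum_j F i j = 2 * \sum_(i < n) \sum_(j < n | (i < j)%N) F i j.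
Proof.
move=> Fs F0.
have E : \sum_(i < n) \sum_(j < n | (j < i)%N) F i j
    = \sum_(i < n) \sum_(j < n | (i < j)%N) F i j.
  rewrite (exchange_big_dep xpredT) //=; apply: eq_bigr => i _.
  by apply: eq_bigr => j _; rewrite Fs.
rewrite -[2]/(1 + 1) mulrDl mul1r -{1}E -big_split; apply: eq_bigr => i _ /=.
rewrite (bigID (fun j : 'I_n => (j < i)%N)) /=; congr (_ + _).
rewrite (bigD1 i) ?ltnn //= F0 add0r; apply: eq_bigl => j.
by rewrite -leqNgt ltn_neqAle andbC eq_sym.
Qed.

(** The three sums of the gap are the cross term and the halves of the two
    square terms of the form at the difference of the two weight
    distributions. *)
Lemma simplex_gap_qform p Q :
  simplex_gap p Q = - (qform (mdist_pow p) (net_weight Q) / 2).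
Proof.
have push (I : finType) (h : I -> X) (w : I -> R) (F : X -> R) :
    \sum_z F z * (\sum_(i | h i == z) w i) = \sum_i w i * F (h i).
  transitivity (\sum_z \sum_(i | h i == z) w i * F (h i)).
    apply: eq_bigr => z _; rewrite mulr_sumr.
    by apply: eq_bigr => i /eqP->; rewrite mulrC.
  rewrite (exchange_big_dep xpredT) //=; apply: eq_bigr => i _.
  by under eq_bigl do rewrite eq_sym; rewrite big_pred1_eq.
pose D := @mdist_pow R X p.
have cross (I J : finType) (h : I -> X) (k : J -> X) (w : I -> R) (v : J -> R) :
    \sum_x \sum_y D x y * (\sum_(i | h i == x) w i) * (\sum_(j | k j == y) v j)
    = \sum_i \sum_j w i * v j * D (h i) (k j).
  under eq_bigr do (under eq_bigr do rewrite mulrAC; rewrite -mulr_suml).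
  rewrite push; apply: eq_bigr => i _; rewrite push mulr_sumr.
  by apply: eq_bigr => j _; rewrite mulrA.
pose f z := \sum_(i < ss_s Q | ss_x i == z) ss_m i.
pose g z := \sum_(j < ss_t Q | ss_y j == z) ss_n j.
rewrite (eq_qformr _ (g := fun z => f z + (-1) * g z)); last first.
  by move=> z; rewrite mulN1r /net_weight.
rewrite qform_line; last exact: mdist_pow_sym.
rewrite /qform !cross.
rewrite (sum_lt_half (F := fun i j => ss_m i * ss_m j * D (ss_x i) (ss_x j))); first last.
- by move=> i; rewrite /D mdist_powxx mulr0.
- by move=> i j; rewrite /D mdist_pow_sym [ss_m i * _]mulrC.
rewrite (sum_lt_half (F := fun i j => ss_n i * ss_n j * D (ss_y i) (ss_y j))); first last.
- by move=> i; rewrite /D mdist_powxx mulr0.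
- by move=> i j; rewrite /D mdist_pow_sym [ss_n i * _]mulrC.
by rewrite /simplex_gap /D; field.
Qed.

(** Put the signed weights on the left-hand side, against a single right-hand
    point of weight zero. *)
Lemma exists_signed_simplex xi : (exists x, xi x != 0) -> \sum_x xi x = 0 ->
  exists Q, forall z, net_weight Q z = xi z.
Proof.
move=> [x0 x00] xi0.
have X0 : (0 < #|X|)%N by apply/card_gt0P; exists x0.
have bal : \sum_(i < #|X|) xi (enum_val i) = \sum_(j < 1) (fun=> 0 : R) j.
  by rewrite big_ord1 -[RHS]xi0 -(big_enum_val xi); exact: eq_bigl.
exists (SignedSimplex X0 (ltn0Sn 0) (fun i => enum_val i) (fun=> x0) bal) => z.
rewrite /net_weight /= [X in _ - X]big1 // subr0.
rewrite -(big_enum_val_cond (pred1 z) xi).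
by rewrite (eq_bigl (pred1 z)) // big_pred1_eq.
Qed.

Lemma admits_nontrivialE p : admits_nontrivial_polygonal_equality X p <->
  exists xi, [/\ exists x, xi x != 0, \sum_x xi x = 0 & qform (mdist_pow p) xi = 0].
Proof.
split=> [[Q [Qnd]]|[xi [xi1 xi0 q0]]].
  rewrite simplex_gap_qform => Q0; exists (net_weight Q); split=> //.
    exact: sum_net_weight.
  lra.
have [Q QE] := exists_signed_simplex xi1 xi0; exists Q; split.
  by case: xi1 => x x0; exists x; rewrite QE.
by rewrite simplex_gap_qform (eq_qformr _ QE) q0 mul0r oppr0.
Qed.

Lemma qform_mdist_pow0 xi : \sum_x xi x = 0 ->
  qform (mdist_pow 0) xi = - \sum_(x : X) xi x ^+ 2.
Proof.
move=> xi0; rewrite (eq_qform (L := fun x y => 1 + (-1) * (x == y)%:R)).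
  by rewrite qformD qform_const1 qformZ qform_diag;
     rewrite xi0 expr0n add0r mulN1r.
move=> x y; rewrite /mdist_pow; case: eqVneq => _; first by rewrite mulr1 subrr.
by rewrite powRr0 mulr0 addr0.
Qed.

Definition strict_negative_type p :=
  forall xi, (exists x, xi x != 0) -> \sum_x xi x = 0 -> qform (@mdist_pow R X p) xi < 0.

(** Positive [p] reduces to the power [p / q] of the conditionally negative
    kernel [d `^ q]; for [p = 0] the form is minus the squared norm. *)
Lemma strict_negative_type_lt p q : 0 <= p -> p < q -> negative_type X q ->
  strict_negative_type p.
Proof.
rewrite le_eqVlt => /predU1P[<- _ _|p0 pq qneg] xi [x0 x00] xi0.
  rewrite qform_mdist_pow0 // oppr_lt0 (bigD1 x0) //= ltr_wpDr //.
    by apply: sumr_ge0 => x _; exact: sqr_ge0.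
  by rewrite exprn_even_gt0.
have q0 : 0 < q by exact: lt_trans pq.
have := @offdiag_powR_lt0 R X (mdist_pow q) (p / q) (mdist_pow_sym q)
  (mdist_powxx q) (@mdist_pow_gt0 q) qneg _ _ xi.
rewrite divr_gt0 // ltr_pdivrMr // mul1r => /(_ isT pq).
rewrite /offdiag_form (eq_qform (L := mdist_pow p)); first by apply=> //; exists x0.
move=> x y; rewrite /mdist_pow; case: eqVneq => // _.
by rewrite -powRrM mulrC divfK // gt_eqF.
Qed.

Lemma continuous_mdist_pow (x y : X) : continuous (fun p : R => mdist_pow p x y).
Proof.
rewrite /mdist_pow; case: eqVneq => [_|xy] p; first exact: cvg_cst.
rewrite /powR gt_eqF ?mdist_gt0 //.
apply: continuous_comp; last exact: continuous_expR.
by apply: cvgMr_tmp; exact: cvg_id.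
Qed.

(** The form is negative at the difference [eta] of two unit vectors. Were it
    nonnegative at some [xi], it would vanish somewhere on the line from [xi]
    in the direction [eta], as a quadratic polynomial with negative leading
    coefficient and nonnegative value at [0] has a real root. *)
Lemma strict_of_no_zero p : (1 < #|X|)%N ->
  ~ admits_nontrivial_polygonal_equality X p -> strict_negative_type p.
Proof.
move=> X2 noz xi xi1 xi0; rewrite ltNge; apply/negP => q_ge0.
have [a [b [_ _ ab]]] := card_gt1P X2.
pose eta (x : X) : R := 1 * (x == a)%:R + (-1) * (x == b)%:R.
pose D := @mdist_pow R X p.
have eta0 : \sum_x eta x = 0.
  by rewrite big_split /= (sum_delta (fun=> 1)) (sum_delta (fun=> -1)) subrr.
pose A := - qform D eta.
have A0 : 0 < A.
  rewrite /A oppr_gt0 qform_two; last exact: mdist_pow_sym.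
  by have := mdist_pow_gt0 p ab; rewrite /D !mdist_powxx; lra.
pose B := \sum_x \sum_y D x y * xi x * eta y.
pose C := qform D xi.
(* The root of [C + 2 B t - A t ^+ 2]. *)
pose t := (B + Num.sqrt (B ^+ 2 + A * C)) / A.
have disc : 0 <= B ^+ 2 + A * C by rewrite addr_ge0 ?sqr_ge0 // mulr_ge0 // ltW.
have root : C + t * (2 * B) + t ^+ 2 * (- A) = 0.
  have s2 := sqr_sqrtr disc.
  set s := Num.sqrt _ in s2 t *.
  have -> : C + t * (2 * B) + t ^+ 2 * (- A) = (B ^+ 2 + A * C - s ^+ 2) / A.
    by rewrite /t; field; rewrite gt_eqF.
  by rewrite s2 subrr mul0r.
apply: noz; apply/admits_nontrivialE; exists (fun x => xi x + t * eta x).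
have sum0 : \sum_x (xi x + t * eta x) = 0.
  by rewrite big_split /= -mulr_sumr xi0 eta0 mulr0 addr0.
have form0 : qform D (fun x => xi x + t * eta x) = 0.
  by rewrite qform_line; [rewrite -[qform D eta]opprK | exact: mdist_pow_sym].
(* The point of the line found is not the origin: otherwise [xi] would be a
   multiple of [eta] and [C] a nonpositive multiple of [A]. *)
split=> //; apply/existsP; apply: contraT; rewrite negb_exists => /forallP z.
have xiE x : xi x = - t * eta x.
  by have := z x; rewrite negbK => /eqP; rewrite mulNr; lra.
have C0 : C = - (t ^+ 2 * A).
  rewrite /C (eq_qformr _ xiE) -(qform_weight _ (fun=> - t)) qformZ /A; ring.
have t2 : t ^+ 2 = 0.
  apply/eqP; rewrite eq_le sqr_ge0 andbT -(pmulr_lle0 _ A0).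
  by have : 0 <= C := q_ge0; rewrite C0; lra.
case: xi1 => x; rewrite xiE; move/eqP: t2; rewrite expf_eq0 /= => /eqP->.
by rewrite oppr0 mul0r eqxx.
Qed.

End Simplex.

(** * Strict negative type is an open condition on the exponent *)

Section Openness.
Variables (R : realType) (X : finMetricType R).

(** The vectors of sum zero and sup norm one form a compact set, on which the
    form attains its maximum. *)
Lemma qform_coercive (D : X -> X -> R) :
  (forall xi : X -> R, (exists x, xi x != 0) -> \sum_x xi x = 0 -> qform D xi < 0) ->
  exists2 c : R, 0 < c &
    forall xi : X -> R, (forall x, `|xi x| <= 1) -> (exists x, `|xi x| = 1) ->
      \sum_x xi x = 0 -> qform D xi <= - c.
Proof.
move=> Dneg.
pose n := #|X|.
pose vec (v : 'rV[R]_n) (x : X) : R := v ord0 (enum_rank x).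
have vec_cont x : continuous (fun v => vec v x) by exact: coord_continuous.
pose sph := [set v : 'rV[R]_n | [/\ forall x, `|vec v x| <= 1, exists x, `|vec v x| = 1
  & \sum_x vec v x = 0]].
have form_cont : continuous (fun v => qform D (vec v)).
  apply: continuous_big => [|x _]; first exact: add_continuous.
  apply: continuous_big => [|y _ v]; first exact: add_continuous.
  apply: (@continuousM _ _ (fun v => D x y * vec v x) (vec^~ y)); last exact: vec_cont.
  by apply: (@continuousM _ _ (cst (D x y)) (vec^~ x));
    [exact: cst_continuous|exact: vec_cont].
have sum_cont : continuous (fun v => \sum_x vec v x).
  by apply: continuous_big => [|x _]; [exact: add_continuous|exact: vec_cont].
have norm_cont x : continuous (fun v => `|vec v x|).
  by move=> v; apply: (@continuous_comp _ _ _ (vec^~ x) Num.norm);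
    [exact: vec_cont|exact: norm_continuous].
have sph_closed : closed sph.
  have -> : sph = [set v | forall x, `|vec v x| <= 1] `&`
      (\bigcup_(x in [set: X]) [set v | `|vec v x| = 1]) `&`
      [set v | \sum_x vec v x = 0].
    apply/seteqP; split=> [v [h1 [x h2] h3]|v [[h1 [x _ h2]] h3]].
      by split=> //; split=> //; exists x.
    by split=> //; exists x.
  apply: closedI; last first.
    exact: (proj1 (continuous_closedP _) sum_cont _ (@closed_eq R 0)).
  apply: closedI.
    have -> : [set v | forall x, `|vec v x| <= 1]
        = \bigcap_(x in [set: X]) [set v | `|vec v x| <= 1].
      by apply/seteqP; split=> [v h x _|v h x]; [exact: h|exact: h].
    apply: closed_bigI => x _.
    exact: (proj1 (continuous_closedP _) (norm_cont x) _ (@closed_le R 1)).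
  apply: closed_bigcup; first exact: finite_finset.
  move=> x _.
  exact: (proj1 (continuous_closedP _) (norm_cont x) _ (@closed_eq R 1)).
have sph_compact : compact sph.
  apply: bounded_closed_compact sph_closed.
  exists 1; split=> [|M M1 v [v1 _ _]]; first exact: num_real.
  apply: le_trans (ltW M1).
  rewrite [leLHS]/Num.norm /= mx_normrE; apply: bigmax_le => // -[i j] _ /=.
  have := v1 (enum_val j); rewrite /vec enum_valK (ord1 i); exact.
have E (xi : X -> R) x : vec (\row_j xi (enum_val j)) x = xi x.
  by rewrite /vec mxE enum_rankK.
have sph_row (xi : X -> R) : (forall x, `|xi x| <= 1) ->
    (exists x, `|xi x| = 1) -> \sum_x xi x = 0 -> sph (\row_j xi (enum_val j)).
  move=> h1 [x hx] h3; split; first by move=> y; rewrite E.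
    by exists x; rewrite E.
  by under eq_bigr do rewrite E.
have [sph0|/set0P sph_nonempty] := eqVneq sph set0.
  by exists 1 => // xi h1 h2 h3; have := sph_row xi h1 h2 h3; rewrite sph0.
have [v0 v0s v0max] := EVT_max_rV sph_nonempty sph_compact (continuous_subspaceT form_cont).
move: v0s; rewrite inE => -[_ [x0 nx0] s0].
exists (- qform D (vec v0)).
  rewrite oppr_gt0; apply: Dneg => //; exists x0.
  by rewrite -normr_gt0 nx0.
move=> xi h1 h2 h3; rewrite opprK -(eq_qformr D (E xi)).
by apply: v0max; rewrite inE; exact: sph_row.
Qed.

(** When [q] is close to [p] the two kernels differ by less, summed over all
    entries, than the coercivity constant at [p]. *)
Lemma strict_negative_type_open (p : R) : strict_negative_type X p ->
  \forall q \near p, negative_type X q.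
Proof.
move=> /qform_coercive[c c0 cP].
have dev : \sum_(x : X) \sum_(y : X) `|mdist_pow q x y - mdist_pow p x y| @[q --> p]
    --> \sum_(x : X) \sum_(y : X) `|mdist_pow p x y - mdist_pow p x y|.
  apply: cvg_big => [|x _]; first exact: add_continuous.
  apply: cvg_big => [|y _]; first exact: add_continuous.
  apply: cvg_norm; apply: cvgB; last exact: cvg_cst.
  exact: continuous_mdist_pow.
rewrite [X in _ --> X]big1 in dev; last first.
  by move=> x _; rewrite big1 // => y _; rewrite subrr normr0.
move/cvgr_lt: dev => /(_ c c0); apply: filterS => q qc xi xi0.
rewrite -[leLHS]/(qform (mdist_pow q) xi).
have [/existsP[x1 x10]|] := boolP [exists x, xi x != 0]; last first.
  rewrite negb_exists => /forallP z; rewrite /qform big1 // => x _.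
  by rewrite big1 // => y _; have := z x; rewrite negbK => /eqP->; rewrite mulr0 mul0r.
have [x0 _ x0max] := @arg_maxP _ _ _ x1 xpredT (fun x => `|xi x|) isT.
set s := `|xi x0| in x0max.
have {}x0max x : `|xi x| <= s by exact: x0max.
have s0 : 0 < s by rewrite (lt_le_trans _ (x0max x1)) // normr_gt0.
pose eta x := s^-1 * xi x.
have eta1 x : `|eta x| <= 1.
  by rewrite normrM normfV (gtr0_norm s0) mulrC ler_pdivrMr // mul1r x0max.
have etaE x : xi x = s * eta x by rewrite mulrA divff ?gt_eqF ?mul1r.
have eta0 : \sum_x eta x = 0 by rewrite -mulr_sumr xi0 mulr0.
have etax : exists x, `|eta x| = 1.
  by exists x0; rewrite normrM normfV (gtr0_norm s0) mulVf ?gt_eqF.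
rewrite (eq_qformr _ etaE) -(qform_weight _ (fun=> s)) qformZ pmulr_rle0 ?mulr_gt0 //.
have := cP eta eta1 etax eta0.
suff : qform (mdist_pow q) eta - qform (mdist_pow p) eta <= c by lra.
apply: le_trans (ltW qc).
rewrite /qform -sumrB; apply: ler_sum => x _; rewrite -sumrB; apply: ler_sum => y _.
rewrite -!mulrBl; apply: le_trans (ler_norm _) _;
rewrite (normrM _ (eta y)) (normrM _ (eta x)) -mulrA.
by rewrite ler_piMr // mulr_ile1.
Qed.

End Openness.

Theorem corollary3p2 (R : realType) (X : finMetricType R)
    (hX : (1 < #|{: X}|)%N)
    (hwp : (supremal_negative_type X < +oo)%E) :
  [set p : R | 0 <= p /\ admits_nontrivial_polygonal_equality X p]
  = [set p : R | (supremal_negative_type X <= p%:E)%E].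
Proof.
apply/seteqP; split=> p /=.
  case=> p0 /admits_nontrivialE[xi [xi1 xi0 q0]]; rewrite leNgt; apply/negP.
  move=> /ereal_sup_gt[_ [q [q_ge0 qneg] <-]]; rewrite lte_fin => pq.
  by have := strict_negative_type_lt p0 pq qneg xi1 xi0; rewrite q0 ltxx.
move=> wp_le.
(* The supremum is nonnegative because [X] is of 0-negative type. *)
have p0 : 0 <= p.
  rewrite -lee_fin; apply: le_trans wp_le; apply: ereal_sup_ubound.
  exists 0 => //; split=> // xi xi0.
  rewrite -[leLHS]/(qform (mdist_pow 0) xi) qform_mdist_pow0 // oppr_le0.
  by apply: sumr_ge0 => x _; exact: sqr_ge0.
split=> //; apply: contrapT => noz.
have /strict_negative_type_open[e /= e0 eP] := strict_of_no_zero hX noz.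
have : ((p + e / 2)%:E <= p%:E)%E.
  apply: le_trans wp_le; apply: ereal_sup_ubound; exists (p + e / 2) => //; split.
    by rewrite addr_ge0 // divr_ge0 // ltW.
  apply: eP => /=; rewrite opprD addNKr normrN gtr0_norm ?divr_gt0 //.
  by rewrite ltr_pdivrMr // ltr_pMr // ltr1n.
by rewrite lee_fin gerDl leNgt divr_gt0.
Qed.
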